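(* Suppose that Assumptions 1--4 (stated in the context) hold. Then the observer $$\dot{\tilde x}\in A\tilde x+B\tilde\omega-Le_y+f(\tilde x,u)-P^{-1}F^T\Big(\kappa_1\,\mathrm{Sign}(e_y)+\frac{\kappa_3 e_y}{\|e_y\|^2+\delta}\Big),\qquad \tilde\omega\in-\mathcal F(C\tilde x-Ke_y),$$ where $e:=\tilde x-x$ and $e_y:=Fe$, is a $T$-observer for the system $$\dot x=Ax+B\omega+f(x,u)+\xi(t),\qquad \omega\in-\mathcal F(Cx),\qquad y=Fx.$$ If in addition Assumption 5 holds, i.e. there exists some $\mu>0$ such that the symmetric block matrix $$\begin{pmatrix}P(A-LF)+(A-LF)^TP+2L_f\|P\|I+2\epsilon I & -P\\ -P & -2\mu\epsilon I\end{pmatrix}$$ is negative semidefinite, then this observer is a strong $H^\infty$ observer for the system.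
   Context: Setting. $A\in\mathbb R^{n\times n}$, $B\in\mathbb R^{n\times m}$, $C\in\mathbb R^{m\times n}$, $F\in\mathbb R^{p\times n}$ are given matrices, $x(t)\in\mathbb R^n$ is the state, $u(t)\in\mathbb R^r$ is a given control input, $y(t)\in\mathbb R^p$ is the measured output, $\xi:[0,\infty)\to\mathbb R^n$ is an unknown uncertainty, $\mathcal F:\mathbb R^m\rightrightarrows\mathbb R^m$ is a set-valued map and $f:\mathbb R^n\times\mathbb R^r\to\mathbb R^n$. $\langle\cdot,\cdot\rangle$ and $\|\cdot\|$ are the Euclidean scalar product and norm; $\|P\|$ is the induced operator norm; $I$ is the identity matrix. For a symmetric matrix $M$, $M\le 0$ means negative semidefinite and $M>0$ means positive definite. $\mathrm{Sign}:\mathbb R^p\rightrightarrows\mathbb R^p$ is the set-valued map $\mathrm{Sign}(z)=\{z/\|z\|\}$ if $z\ne0$ and $\mathrm{Sign}(0)$ is the closed unit ball. Solutions of the system and of the observer are locally absolutely continuous functions $x,\tilde x:[0,\infty)\to\mathbb R^n$ together with functions $\omega,\tilde\omega:[0,\infty)\to\mathbb R^m$ such that the relations hold for almost every $t\ge 0$ (existence of such solutions is taken for granted). Assumption 1. $\mathcal F$ is maximal monotone, i.e. $\langle x^*-y^*,x-y\rangle\ge0$ whenever $x^*\in\mathcal F(x)$, $y^*\in\mathcal F(y)$, and the graph of $\mathcal F$ is not strictly contained in the graph of another monotone operator. Assumption 2. There is $L_f\ge 0$ with $\|f(x_1,u)-f(x_2,u)\|\le L_f\|x_1-x_2\|$ for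 all $x_1,x_2\in\mathbb R^n$, $u\in\mathbb R^r$. Assumption 3. There exist $\epsilon>0$, a symmetric $P\in\mathbb R^{n\times n}$ with $P>0$, $L\in\mathbb R^{n\times p}$ and $K\in\mathbb R^{m\times p}$ such that $$P(A-LF)+(A-LF)^TP+2L_f\|P\|I+2\epsilon I\le0,\qquad B^TP=C-KF.$$ These $\epsilon,P,L,K$ are fixed and used in the observer and in Assumption 5. Assumption 4. $\xi$ is continuous and decomposed as $\xi(t)=P^{-1}F^T\xi_1(t)+\xi_2(t)$, where $P^{-1}F^T\xi_1(t)$ is the (orthogonal) projection of $\xi(t)$ onto $\mathrm{Im}(P^{-1}F^T)$ (so $FP^{-1}\xi_2(t)=0$), and $\|\xi_1(t)\|\le\kappa_1(t)$, $\|\xi_2(t)\|\le\kappa_2(t)$ for all $t\ge0$, where $\kappa_1,\kappa_2:[0,\infty)\to(0,\infty)$ are known continuous functions. In the observer, $\delta>0$ is a given constant and $\kappa_3:[0,\infty)\to[0,\infty)$ is a continuous gain function. Definition ($T$-observer). The observer is called a $T$-observer for the system if the error $t\mapsto e(t)$ is asymptotically stable for $\xi\equiv0$ and, for non-zero $\xi\in L^2(0,\infty)$, there exists $\mu>0$ such that $$\|e(t)\|\le\gamma(t)+\mu\sqrt{\int_0^t\|\xi(s)\|^2ds}\qquad\text{for all }t\ge0,$$ where $\gamma(t)$ vanishes under zero initial condition (i.e. $e(0)=0$) and converges exponentially to zero in the remaining case. Definition (strong $H^\infty$ observer). The observer is called a strong $H^\infty$ observer for the system if the error $t\mapsto e(t)$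 is asymptotically stable for $\xi\equiv0$ and, for non-zero $\xi\in L^2(0,\infty)$, there exists $\mu>0$ such that $$\|e\|_{L^2(0,\infty)}\le C_0+\mu\|\xi\|_{L^2(0,\infty)},$$ where $C_0$ is a non-negative constant that vanishes under zero initial condition (i.e. $e(0)=0$). *)

(* Defs.v *)
From mathcomp Require Import all_boot all_order all_algebra.
From mathcomp Require Import all_classical all_reals all_analysis.

Set Implicit Arguments.
Unset Strict Implicit.
Unset Printing Implicit Defensive.

Import Order.TTheory GRing.Theory Num.Theory.
Import numFieldNormedType.Exports.

Local Open Scope classical_set_scope.
Local Open Scope ring_scope.

(* The library norm on matrices is the sup norm, whence the Euclidean product
   and norm below. Topological notions (continuity, derivatives, limits) use
   the library topology on ['cV[R]_n], which is the Euclidean one. *)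
Definition dot (R : realType) (n : nat) (v w : 'cV[R]_n) : R :=
  (v^T *m w) 0 0.

Definition enorm (R : realType) (n : nat) (v : 'cV[R]_n) : R :=
  Num.sqrt (dot v v).

Definition opnorm (R : realType) (m n : nat) (M : 'M[R]_(m, n)) : R :=
  sup [set enorm (M *m v) | v in [set v : 'cV[R]_n | enorm v <= 1]].

Definition posdef (R : realType) (n : nat) (M : 'M[R]_n) : Prop :=
  M^T = M /\ forall v : 'cV[R]_n, v != 0 -> 0 < dot v (M *m v).

Definition neg_semidef (R : realType) (n : nat) (M : 'M[R]_n) : Prop :=
  M^T = M /\ forall v : 'cV[R]_n, dot v (M *m v) <= 0.

Definition orthogonal_projection (R : realType) (n : nat)
    (S : set 'cV[R]_n) (v w : 'cV[R]_n) : Prop :=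
  S w /\ forall z, S z -> dot (v - w) z = 0.

Definition monotone (R : realType) (m : nat)
    (T : 'cV[R]_m -> set 'cV[R]_m) : Prop :=
  forall v w v' w', T v v' -> T w w' -> 0 <= dot (v' - w') (v - w).

Definition maximal_monotone (R : realType) (m : nat)
    (T : 'cV[R]_m -> set 'cV[R]_m) : Prop :=
  monotone T /\
  forall G : 'cV[R]_m -> set 'cV[R]_m,
    monotone G -> (forall v, T v `<=` G v) -> forall v, G v `<=` T v.

Definition Sign (R : realType) (p : nat) (z : 'cV[R]_p) : set 'cV[R]_p :=
  if z == 0 then [set s | enorm s <= 1] else [set (enorm z)^-1 *: z].

(* Functions of time are total on [R]; only their values on [0, +oo[ are ever
   constrained or used. *)
Definition traj (R : realType) (n : nat) := R -> 'cV[R]_n.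

Definition abs_continuous (R : realType) (n : nat) (a b : R)
    (x : traj R n) : Prop :=
  forall eps : R, 0 < eps -> exists2 delta : R, 0 < delta &
    forall (k : nat) (I : 'I_k -> R * R),
      (forall i, a <= (I i).1 /\ (I i).1 <= (I i).2 /\ (I i).2 <= b) ->
      trivIset setT (fun i => `](I i).1, (I i).2[%classic) ->
      \sum_(i < k) ((I i).2 - (I i).1) < delta ->
      \sum_(i < k) enorm (x (I i).2 - x (I i).1) < eps.

Definition loc_abs_continuous (R : realType) (n : nat) (x : traj R n) : Prop :=
  forall b : R, 0 <= b -> abs_continuous 0 b x.

(* L^2(0, +oo) norm, as an extended real. *)
Definition L2norm (R : realType) (n : nat) (g : traj R n) : \bar R :=
  Lnorm (@lebesgue_measure R) 2%:E
    (EFin \o ((fun t : R => enorm (g t)) \_ `]0, +oo[)).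

Section Observers.
Context (R : realType) (n p : nat).

(* A plant sends a disturbance to the set of its possible (state, output)
   pairs; an observer sends an output signal to the set of its possible
   estimates. *)
Definition plant := traj R n -> set (traj R n * traj R p).
Definition observer := traj R p -> set (traj R n).

Definition errors (sys : plant) (obs : observer) (xi : traj R n)
  : set (traj R n) :=
  [set e | exists x y xt,
     [/\ sys xi (x, y), obs y xt & e = (fun t => xt t - x t)]].

Definition asymptotically_stable (E : set (traj R n)) : Prop :=
  (forall eps : R, 0 < eps -> exists2 delta : R, 0 < delta &
     forall e, E e -> enorm (e 0) < delta ->
       forall t : R, 0 <= t -> enorm (e t) < eps) /\
  (forall e, E e -> e t @[t --> +oo] --> (0 : 'cV[R]_n)).

Definition nonzero_L2 (xi : traj R n) : Prop :=
  (exists2 t : R, 0 <= t & xi t != 0) /\ (L2norm xi < +oo)%E.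

Definition exponentially_vanishing (g : R -> R) : Prop :=
  exists a c : R, 0 < c /\ forall t : R, 0 <= t -> `|g t| <= a * expR (- (c * t)).

(* [W] is the class of admissible disturbances. The gain [mu] is uniform in the
   disturbance and in the solutions; [gamma] (resp. [C0]) depends only on the
   initial error. *)
Definition T_observer (W : set (traj R n)) (sys : plant) (obs : observer)
  : Prop :=
  asymptotically_stable (errors sys obs (fun=> 0)) /\
  exists (mu : R) (gamma : 'cV[R]_n -> R -> R),
    [/\ 0 < mu,
        forall t : R, 0 <= t -> gamma 0 t = 0,
        forall e0, e0 != 0 -> exponentially_vanishing (gamma e0) &
        forall xi, W xi -> nonzero_L2 xi ->
        forall e, errors sys obs xi e -> forall t : R, 0 <= t ->
          enorm (e t) <= gamma (e 0) t +
            mu * Num.sqrt (\int[@lebesgue_measure R]_(s in `[0, t])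
                             enorm (xi s) ^+ 2)].

Definition strong_Hinfty_observer (W : set (traj R n)) (sys : plant)
    (obs : observer) : Prop :=
  asymptotically_stable (errors sys obs (fun=> 0)) /\
  exists (mu : R) (C0 : 'cV[R]_n -> R),
    [/\ 0 < mu,
        forall e0, 0 <= C0 e0,
        C0 0 = 0 &
        forall xi, W xi -> nonzero_L2 xi ->
        forall e, errors sys obs xi e ->
          (L2norm e <= (C0 (e 0))%:E + mu%:E * L2norm xi)%E].

End Observers.

Section System.
Context (R : realType) (n m p r : nat).
Variables (A : 'M[R]_n) (B : 'M[R]_(n, m)) (C : 'M[R]_(m, n)).
Variables (F : 'M[R]_(p, n)) (calF : 'cV[R]_m -> set 'cV[R]_m).
Variables (f : 'cV[R]_n -> 'cV[R]_r -> 'cV[R]_n) (u : traj R r).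

Definition lure_system : plant R n p := fun xi => [set xy : traj R n * traj R p |
  let x := xy.1 in let y := xy.2 in
  [/\ loc_abs_continuous x,
      forall t : R, 0 <= t -> y t = F *m x t &
      exists omega : traj R m,
        {ae @lebesgue_measure R, forall t : R, 0 <= t ->
           is_derive t 1 x (A *m x t + B *m omega t + f (x t) (u t) + xi t) /\
           calF (C *m x t) (- omega t)}]].

Variables (P : 'M[R]_n) (L : 'M[R]_(n, p)) (K : 'M[R]_(m, p)).

(* The output error [ey = F xt - y] equals [F e], with [e = xt - x] and
   [y = F x]. *)
Definition sliding_observer (kappa1 kappa3 : R -> R) (delta : R)
  : observer R n p := fun y => [set xt : traj R n |
  let ey t := F *m xt t - y t in
  loc_abs_continuous xt /\
  exists omega : traj R m,
    {ae @lebesgue_measure R, forall t : R, 0 <= t ->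
       (exists2 s, Sign (ey t) s &
          is_derive t 1 xt
            (A *m xt t + B *m omega t - L *m ey t + f (xt t) (u t)
             - (invmx P *m F^T) *m
                 (kappa1 t *: s
                  + (kappa3 t / (enorm (ey t) ^+ 2 + delta)) *: ey t))) /\
       calF (C *m xt t - K *m ey t) (- omega t)}].

Definition lmi_mx (Lf eps : R) : 'M[R]_n :=
  P *m (A - L *m F) + (A - L *m F)^T *m P
  + (2 * Lf * opnorm P)%:M + (2 * eps)%:M.

Definition admissible_uncertainty (kappa1 kappa2 : R -> R)
  : set (traj R n) := [set xi : traj R n |
  {within `[0, +oo[, continuous (xi : R -> 'cV[R]_n)} /\
  exists (xi1 : traj R p) (xi2 : traj R n), forall t : R, 0 <= t ->
    [/\ xi t = invmx P *m F^T *m xi1 t + xi2 t,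
        orthogonal_projection (range (mulmx (invmx P *m F^T) : 'cV_p -> 'cV_n))
          (xi t) (invmx P *m F^T *m xi1 t),
        enorm (xi1 t) <= kappa1 t &
        enorm (xi2 t) <= kappa2 t]].

End System.

(* Main.v *)
(* Along the error e the function V = <Pe, e> satisfies, for almost every t,
   V' <= - eps |e|^2 + c |xi|^2: the first matrix inequality absorbs the linear
   and the Lipschitz part, monotonicity of calF (with B^T P = C - K F) the
   set-valued one, the sliding term kappa1 Sign(F e) the component of xi along
   the range of P^-1 F^T, and what remains of xi is no longer than xi itself,
   being the residual of an orthogonal projection. Integrating this inequality
   gives the L^2 bound, and integrating it against exp(a t) the pointwise one.
   The integrations rest on the fact that an absolutely continuous function
   with almost everywhere nonpositive derivative is nonincreasing. *)
Require Import Defs.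
From mathcomp Require Import all_boot all_order all_algebra.
From mathcomp Require Import ring lra.
From mathcomp Require Import all_classical all_reals all_analysis.
From mathcomp Require Import measurable_realfun.

Set Implicit Arguments.
Unset Strict Implicit.
Unset Printing Implicit Defensive.

Import Order.TTheory GRing.Theory Num.Theory.
Import numFieldNormedType.Exports.

Local Open Scope classical_set_scope.
Local Open Scope ring_scope.

(** * Absolutely continuous functions with nonpositive derivative *)

(** Real induction. The supremum of the points of [a, b] where [Q] holds satisfies [Q] by the local
    condition there, and the same condition would lead past it unless it is b. The relation [S] is
    only ever tested on intervals having the centre [c] as an endpoint. *)
Lemma chain_induction {R : realType} (a b : R) (Q : R -> Prop)
    (S : R -> R -> Prop) :
  a <= b -> Q a ->
  (forall s t, a <= s -> s <= t -> t <= b -> S s t -> Q s -> Q t) ->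
  (forall c, a <= c <= b -> exists2 d, 0 < d &
     forall s t, s <= c -> c <= t -> a <= s -> t <= b ->
       c - d < s -> t < c + d -> S s c /\ S c t) ->
  Q b.
Proof.
move=> ab Qa QS loc.
pose X := [set t | a <= t <= b /\ Q t].
have Xa : X a by split=> //; rewrite lexx.
have hsX : has_sup X by split; [exists a | exists b => t [/andP[]]].
have Xle t : X t -> t <= sup X by move=> Xt; exact: sup_upper_bound.
have supab : a <= sup X <= b.
  by rewrite Xle//= ge_sup//; [exists a | move=> t [/andP[]]].
have [d d0 locd] := loc _ supab.
move: supab => /andP[asup supb].
have [s [/andP[as_ sb] Qs] ds] := sup_adherent d0 hsX.
have ssup : s <= sup X by apply: Xle; split=> //; rewrite as_ sb.
have Qsup : Q (sup X).
  apply: (QS s) => //.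
  by have [] := locd s (sup X) ssup (lexx _) as_ supb ds ltac:(lra).
(* A step of d / 2 to the right, cut at b. Since [Q t] forces t <= sup X, the minimum has to be
   b. *)
pose t := Num.min b (sup X + d / 2).
have tb : t <= b by rewrite ge_min lexx.
have supt : sup X <= t by rewrite le_min supb /=; lra.
have tsup : t <= sup X + d / 2 by rewrite ge_min lexx orbT.
have Qt : Q t.
  apply: (QS (sup X)) => //.
  by have [] := locd s t ssup supt as_ tb ds ltac:(lra).
have : t <= sup X by apply: Xle; split=> //; rewrite tb (le_trans asup).
move=> tle; rewrite (_ : b = t)//.
by move: tle; rewrite /t; case: (leP b (sup X + d / 2)) => //; lra.
Qed.

Lemma sum_itv_le_lebesgue {R : realType} (U : set R) (k : nat)
    (I : nat -> R * R) :
  measurable U ->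
  (forall i, (i < k)%N -> (I i).1 <= (I i).2 /\ `](I i).1, (I i).2[ `<=` U) ->
  trivIset `I_k (fun i => `](I i).1, (I i).2[%classic) ->
  ((\sum_(i < k) ((I i).2 - (I i).1))%:E <= lebesgue_measure U)%E.
Proof.
move=> mU IU Itriv.
(* Padding with empty sets gives a sequence of sets disjoint over all indices, to which finite
   additivity applies. *)
pose G i := if (i < k)%N then `](I i).1, (I i).2[%classic else set0.
have Gtriv : trivIset setT G.
  apply/trivIsetP => i j _ _ ij; rewrite /G.
  case: ltnP => ik; last by rewrite set0I.
  case: ltnP => jk; last by rewrite setI0.
  by move/trivIsetP : Itriv; apply.
have mG i : measurable (G i) by rewrite /G; case: ifP.
apply: (@le_trans _ _ (lebesgue_measure (\big[setU/set0]_(i < k) G i))).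
  rewrite measure_bigsetU//= -sumEFin; apply: lee_sum => i _.
  rewrite /G ltn_ord lebesgue_measure_itv/= lte_fin.
  by have [I12 _] := IU i (ltn_ord i); case: ltgtP I12 => // ->; rewrite subrr.
apply: le_measure; rewrite ?inE//.
  by apply: bigsetU_measurable => i _; exact: mG.
move=> x; rewrite -bigcup_mkord => -[i /= ik]; rewrite /G ik.
by have [_] := IU i ik; exact.
Qed.

(** Near t the difference quotient is at most d + eps <= eps. Multiplying out depends on the side of
    t, whence the two estimates, one for each kind of interval that [chain_induction] tests at t. *)
Lemma is_derive_le0_near {R : realType} (g : R -> R) (t d eps : R) :
  is_derive t 1 g d -> d <= 0 -> 0 < eps ->
  exists2 dl, 0 < dl & forall s, `|s - t| < dl ->
    (t <= s -> g s - g t <= eps * (s - t)) /\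
    (s <= t -> g t - g s <= eps * (t - s)).
Proof.
move=> [/cvg_ex[l gl] gd] d0 e0.
have ld : l = d by rewrite -gd; apply/esym/cvg_lim.
rewrite {}ld in gl => {gd l}.
move/cvgrPdist_le: gl => /(_ _ e0); rewrite near_withinE.
move/nbhs_ballP => [dl /= dl0 dlP]; exists dl => // s st.
have [->|sNt] := eqVneq s t; first by rewrite !subrr mulr0.
have s0 : s - t != 0 by rewrite subr_eq0.
have := dlP (s - t).
rewrite -ball_normE /= sub0r normrN => /(_ st s0).
rewrite [(s - t) *: 1]mulr1 subrK -[_ *: _]/(_ * _) ler_distl => /andP[q _].
split => ts.
  have h : 0 < s - t by rewrite lt_neqAle eq_sym s0 subr_ge0.
  have : (s - t)^-1 * (g s - g t) <= eps by lra.
  by rewrite mulrC ler_pdivrMr.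
have h : 0 < t - s.
  by rewrite lt_neqAle eq_sym -opprB oppr_eq0 s0 opprB subr_ge0.
have : (s - t)^-1 * (g s - g t) <= eps by lra.
rewrite -(opprB t s) invrN mulNr -mulrN opprB mulrC ler_pdivrMr//.
Qed.

(** The property propagated from a to b by [chain_induction]: growth at rate [eps], up to the
    increments of [g] over finitely many successive intervals inside [U]. *)
Definition covered_growth {R : realType} (U : set R) (a eps : R) (g : R -> R)
    (t : R) : Prop :=
  exists (k : nat) (I : nat -> R * R),
    [/\ forall i, (i < k)%N -> [/\ a <= (I i).1, (I i).1 <= (I i).2,
          (I i).2 <= t & `](I i).1, (I i).2[ `<=` U],
        forall i j, (i < j < k)%N -> (I i).2 <= (I j).1 &
        g t - g a <= eps * (t - a) + \sum_(i < k) `|g (I i).2 - g (I i).1|].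

(** A slow step is absorbed by the linear term. A step inside [U] is appended as the last interval,
    which respects the order because all earlier intervals end by s. *)
Lemma covered_growth_step {R : realType} (U : set R) (a eps : R) (g : R -> R)
    (s t : R) :
  0 <= eps -> a <= s -> s <= t ->
  g t - g s <= eps * (t - s) \/ `](s), t[ `<=` U ->
  covered_growth U a eps g s -> covered_growth U a eps g t.
Proof.
move=> e0 as_ st gU [k [I [IU Iord gs]]].
case: gU => [gst|stU].
  exists k, I; split => // [i /IU[? ? /le_trans is_ ?]|].
    by split=> //; exact: is_.
  by move: gs gst; rewrite !mulrBr; lra.
pose I' i := if i == k then (s, t) else I i.
have I'k i : (i < k)%N -> I' i = I i by move=> ik; rewrite /I' ltn_eqF.
exists k.+1, I'; split=> [i|i j|].
- rewrite ltnS leq_eqVlt => /predU1P[->|ik]; first by rewrite /I' eqxx.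
  rewrite I'k//; have [? ? ? ?] := IU _ ik; split => //; exact: le_trans st.
- move=> /andP[ij]; rewrite ltnS leq_eqVlt => /predU1P[jk|jk].
    rewrite {2}/I' jk eqxx I'k -?jk//=.
    by have [] := IU i; rewrite -?jk.
  by rewrite !I'k ?(ltn_trans ij)//; apply: Iord; rewrite ij.
- rewrite big_ord_recr/= {3 4}/I' eqxx /=.
  under eq_bigr do rewrite I'k//.
  have := ler_norm (g t - g s).
  have : 0 <= eps * (t - s) by rewrite mulr_ge0// subr_ge0.
  by move: gs; rewrite !mulrBr; lra.
Qed.

(** Outer regularity around a measurable null set [N] containing the exceptional points: it makes
    [U] minus [N] small, and [N] adds no measure. *)
Lemma ae_open_cover {R : realType} (P : R -> Prop) (delta : R) :
  {ae @lebesgue_measure R, forall t, P t} -> 0 < delta ->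
  exists U : set R, [/\ open U, ~` [set t | P t] `<=` U &
    (lebesgue_measure U < delta%:E)%E].
Proof.
move=> [N [mN N0 PN]] d0.
have [|U [oU NU Ud]] := lebesgue_regularity_outer mN _ d0.
  by rewrite [X in (X < _)%E](_ : _ = 0)%E.
exists U; split => //; first exact: subset_trans NU.
rewrite -(setDUK NU) measureU ?[X in (X + _)%E](_ : _ = 0)%E ?add0e//.
- by apply: measurableD => //; exact: open_measurable.
- by rewrite setDIK.
Qed.

(* Off a small open set [U] covering the exceptional points [g] grows at rate at
   most [eps]; on [U] its total growth is small by absolute continuity. *)
Lemma abs_continuous_ae_derive_le0 {R : realType} {n : nat} (a b M : R)
    (x : traj R n) (g : R -> R) :
  a <= b -> 0 < M -> abs_continuous a b x ->
  (forall s t, a <= s -> s <= t -> t <= b ->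
     `|g t - g s| <= M * (enorm (x t - x s) + (t - s))) ->
  {ae @lebesgue_measure R, forall t, a <= t <= b ->
     exists2 d, is_derive t 1 g d & d <= 0} ->
  g b <= g a.
Proof.
move=> ab M0 xac gx gae.
suff gab eps : 0 < eps -> g b - g a <= eps * (b - a) + eps.
  (* If g b - g a were positive, the choice of eps below would make the right-hand side equal to
     half of it. *)
  rewrite -subr_le0 leNgt; apply/negP => gab0.
  have d0 : 0 < 2 * (b - a + 1) by lra.
  have := gab ((g b - g a) / (2 * (b - a + 1))) (divr_gt0 gab0 d0).
  have : (g b - g a) / (2 * (b - a + 1)) * (b - a + 1) = (g b - g a) / 2.
    by field; rewrite gt_eqF//; lra.
  by rewrite mulrDr mulr1; lra.
move=> eps0.
have eta0 : 0 < eps / (2 * M) by rewrite divr_gt0//; lra.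
have [dl dl0 xdl] := xac _ eta0.
(* The measure of [U] is used twice: below [dl] it triggers absolute continuity of [x], and below
   eps / (2 M) it controls the time increments in the bound on [g]. *)
have dl'0 : 0 < Num.min dl (eps / (2 * M)) by rewrite lt_min dl0.
have [U [oU gU Udl]] := ae_open_cover gae dl'0.
have : covered_growth U a eps g b.
  apply: (@chain_induction _ a b _
    (fun s t => g t - g s <= eps * (t - s) \/ `](s), t[ `<=` U) ab).
  - exists 0%N, (fun=> (a, a)); split => //.
    by rewrite big_ord0 !subrr mulr0 addr0.
  - move=> s t as_ st tb; apply: covered_growth_step => //; exact: ltW.
  (* Where the derivative exists and is nonpositive, short intervals ending or starting at c are
     slow; any other c lies in the open set [U], and so do short intervals around it. *)
  move=> c acb; have [[d gd d0]|gNc] := pselect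
    (exists2 d, is_derive c 1 g d & d <= 0).
    have [e e0 ge] := is_derive_le0_near gd d0 eps0.
    exists e => // s t sc ct _ _ cs tc.
    have [_ /(_ sc) hs] := ge s ltac:(by rewrite ltr_norml; apply/andP; lra).
    by have [/(_ ct) ht _] := ge t ltac:(by rewrite ltr_norml; apply/andP; lra);
      split; left.
  have Uc : U c by apply: gU => /(_ acb).
  move: (open_nbhs_nbhs (conj oU Uc)) => /nbhs_ballP[e /= e0 eU].
  exists e => // s t sc ct _ _ cs tc; split; right => z /=;
    rewrite in_itv/= => /andP[? ?]; apply: eU; rewrite -ball_normE /=
    ltr_norml; apply/andP; lra.
move=> [k [I [IU Iord gab]]].
have Itriv : trivIset `I_k (fun i => `](I i).1, (I i).2[%classic).
  apply/trivIsetP => i j /= ik jk ij; apply/seteqP; split => // z /=.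
  rewrite !in_itv/= => -[/andP[z1 z2] /andP[z3 z4]].
  move: ij; rewrite neq_ltn => /orP[ij|ij].
    by have := Iord i j; rewrite ij jk => /(_ isT); lra.
  by have := Iord j i; rewrite ij ik => /(_ isT); lra.
have Ilen : \sum_(i < k) ((I i).2 - (I i).1) < Num.min dl (eps / (2 * M)).
  rewrite -lte_fin; apply: le_lt_trans Udl; apply: sum_itv_le_lebesgue => //.
    exact: open_measurable.
  by move=> i /IU[].
have := xdl k (fun i : 'I_k => I i) _ _ (lt_le_trans Ilen _).
rewrite ge_min lexx => /(_ _ _ isT) Ix.
have {}Ix : \sum_(i < k) enorm (x (I i).2 - x (I i).1) < eps / (2 * M).
  apply: Ix => [i|].
    have [? ? ?] := IU i (ltn_ord i); split => //; split => //.
  apply/trivIsetP => i j _ _ ij; move/trivIsetP : Itriv; apply => //=.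
have {}Ilen : \sum_(i < k) ((I i).2 - (I i).1) < eps / (2 * M).
  by apply: lt_le_trans Ilen _; rewrite ge_min lexx orbT.
apply: (le_trans gab); rewrite lerD2l.
apply: (@le_trans _ _ (M * (\sum_(i < k) enorm (x (I i).2 - x (I i).1)
                          + \sum_(i < k) ((I i).2 - (I i).1)))).
  rewrite -big_split mulr_sumr; apply: ler_sum => i _.
  by have [? ? ? _] := IU i (ltn_ord i); exact: gx.
rewrite mulrC -ler_pdivlMr//.
have -> : eps / M = eps / (2 * M) + eps / (2 * M).
  by rewrite invfM; field; rewrite gt_eqF.
by rewrite lerD// ltW.
Qed.

(** * Euclidean product and norm *)

Lemma discriminant_le0 {R : realFieldType} (a b c : R) :
  (forall t, 0 <= c + 2 * t * b + t ^+ 2 * a) -> b ^+ 2 <= a * c.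
Proof.
move=> h; have [a0|a0|a0] := ltgtP a 0.
(* A negative leading coefficient is contradictory: with u = - c / a >= 0, the values at 1 + u and -
   (1 + u) have a negative sum. *)
- have c0 := h 0; rewrite mulr0 mul0r expr0n/= mul0r !addr0 in c0.
  pose u := - (c / a); have u0 : 0 <= u.
    by rewrite oppr_ge0 mulr_ge0_le0// invr_le0 ltW.
  have ua : u * a = - c by rewrite mulNr mulfVK// lt_eqF.
  by have := h (1 + u); have := h (- (1 + u)); nra.
(* The minimum of the quadratic polynomial. *)
- have := h (- (b / a)).
  have : b = (b / a) * a by rewrite mulfVK// gt_eqF.
  by move: (b / a) => u -> /(mulr_ge0 (ltW a0)); lra.
- rewrite a0 mul0r; have [->|b0] := eqVneq b 0; first by rewrite expr0n.
  (* With a = 0 and b nonzero, the affine function takes the value -1 at this point. *)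
  have := h (- ((c + 1) / (2 * b))).
  rewrite (_ : 2 * _ * b = - (c + 1)); first by rewrite a0; lra.
  by field.
Qed.

Section euclidean.
Context {R : realType}.
Implicit Types (m n : nat).

Lemma dotE n (v w : 'cV[R]_n) : dot v w = \sum_i v i 0 * w i 0.
Proof. by rewrite /dot mxE; apply: eq_bigr => i _; rewrite mxE. Qed.

Lemma dotC n (v w : 'cV[R]_n) : dot v w = dot w v.
Proof. by rewrite !dotE; apply: eq_bigr => i _; rewrite mulrC. Qed.

Lemma dotDr n (u v w : 'cV[R]_n) : dot u (v + w) = dot u v + dot u w.
Proof. by rewrite /dot mulmxDr mxE. Qed.

Lemma dotDl n (u v w : 'cV[R]_n) : dot (u + v) w = dot u w + dot v w.
Proof. by rewrite !(dotC _ w) dotDr. Qed.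

Lemma dotZr n a (u v : 'cV[R]_n) : dot u (a *: v) = a * dot u v.
Proof. by rewrite /dot -scalemxAr mxE. Qed.

Lemma dotZl n a (u v : 'cV[R]_n) : dot (a *: u) v = a * dot u v.
Proof. by rewrite !(dotC _ v) dotZr. Qed.

Lemma dotNr n (u v : 'cV[R]_n) : dot u (- v) = - dot u v.
Proof. by rewrite -scaleN1r dotZr mulN1r. Qed.

Lemma dotNl n (u v : 'cV[R]_n) : dot (- u) v = - dot u v.
Proof. by rewrite -scaleN1r dotZl mulN1r. Qed.

Lemma dotBr n (u v w : 'cV[R]_n) : dot u (v - w) = dot u v - dot u w.
Proof. by rewrite dotDr dotNr. Qed.

Lemma dot0l n (v : 'cV[R]_n) : dot 0 v = 0.
Proof. by rewrite -(scale0r 0) dotZl mul0r. Qed.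

Lemma dot_mulmx m n (M : 'M[R]_(m, n)) u v :
  dot u (M *m v) = dot (M^T *m u) v.
Proof. by rewrite /dot trmx_mul trmxK mulmxA. Qed.

Lemma dot_ge0 n (v : 'cV[R]_n) : 0 <= dot v v.
Proof. by rewrite dotE sumr_ge0// => i _; rewrite -expr2 sqr_ge0. Qed.

Lemma enorm_ge0 n (v : 'cV[R]_n) : 0 <= enorm v.
Proof. exact: sqrtr_ge0. Qed.

Lemma sqr_enorm n (v : 'cV[R]_n) : enorm v ^+ 2 = dot v v.
Proof. by rewrite sqr_sqrtr// dot_ge0. Qed.

Lemma enorm0 n : enorm (0 : 'cV[R]_n) = 0.
Proof. by rewrite /enorm dot0l sqrtr0. Qed.

Lemma enormZ n a (v : 'cV[R]_n) : enorm (a *: v) = `|a| * enorm v.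
Proof.
by rewrite /enorm dotZl dotZr mulrA -expr2 sqrtrM ?sqr_ge0// sqrtr_sqr.
Qed.

Lemma enormN n (v : 'cV[R]_n) : enorm (- v) = enorm v.
Proof. by rewrite -scaleN1r enormZ normrN1 mul1r. Qed.

Lemma ler_coord_enorm n (v : 'cV[R]_n) i : `|v i 0| <= enorm v.
Proof.
rewrite -sqrtr_sqr ler_sqrt ?dot_ge0// dotE (bigD1 i)//= -expr2 lerDl.
by rewrite sumr_ge0// => j _; rewrite -expr2 sqr_ge0.
Qed.

Lemma enorm_eq0 n (v : 'cV[R]_n) : (enorm v == 0) = (v == 0).
Proof.
apply/idP/eqP => [/eqP v0|->]; last by rewrite enorm0.
apply/colP => i; apply/eqP; rewrite mxE -normr_le0.
by rewrite (le_trans (ler_coord_enorm v i))// v0.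
Qed.

(** The form at u + t v is a nonnegative quadratic polynomial in t. Taking [M] to be the identity
    gives the Euclidean inequality; taking it to be P gives coercivity of P. *)
Lemma psd_cauchy_schwarz n (M : 'M[R]_n) (u v : 'cV[R]_n) :
  M^T = M -> (forall w : 'cV[R]_n, 0 <= dot w (M *m w)) ->
  dot u (M *m v) ^+ 2 <= dot v (M *m v) * dot u (M *m u).
Proof.
move=> MT M0; apply: discriminant_le0 => t.
have := M0 (u + t *: v).
rewrite mulmxDr -scalemxAr !dotDl !dotDr !dotZr !dotZl.
rewrite (_ : dot v (M *m u) = dot u (M *m v)); last first.
  by rewrite dot_mulmx MT dotC.
by lra.
Qed.

Lemma cauchy_schwarz n (u v : 'cV[R]_n) : dot u v <= enorm u * enorm v.
Proof.
have := @psd_cauchy_schwarz n 1%:M u v (trmx1 _ _).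
rewrite !mul1mx => /(_ (fun w => ltac:(rewrite mul1mx; exact: dot_ge0))) uv.
apply: le_trans (ler_norm _) _.
rewrite /enorm -sqrtrM ?dot_ge0// -sqrtr_sqr ler_sqrt ?mulr_ge0 ?dot_ge0//.
by rewrite mulrC.
Qed.

Lemma ler_enormD n (u v : 'cV[R]_n) : enorm (u + v) <= enorm u + enorm v.
Proof.
rewrite -(@ler_pXn2r _ 2)// ?nnegrE ?addr_ge0 ?enorm_ge0//.
rewrite sqrrD !sqr_enorm dotDl !dotDr (dotC v u).
by have := cauchy_schwarz u v; lra.
Qed.

Lemma ler_dist_enorm n (u v : 'cV[R]_n) :
  `|enorm u - enorm v| <= enorm (u - v).
Proof.
have := ler_enormD (u - v) v; have := ler_enormD (v - u) u.
by rewrite !subrK -(opprB u v) enormN ler_norml => ? ?; apply/andP; lra.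
Qed.

Lemma mulmx_bounded m n (M : 'M[R]_(m, n)) :
  exists2 c, 0 < c & forall v : 'cV[R]_n, enorm (M *m v) <= c * enorm v.
Proof.
(* The squared Frobenius norm, which bounds [M] through Cauchy-Schwarz on each row; adding 1 to its
   root makes the constant positive even for a zero matrix. *)
pose c2 : R := \sum_i dot (row i M)^T (row i M)^T.
have c20 : 0 <= c2 by rewrite sumr_ge0// => i _; exact: dot_ge0.
exists (Num.sqrt c2 + 1) => [|v]; first by rewrite ltr_wpDl ?sqrtr_ge0.
apply: (@le_trans _ _ (Num.sqrt c2 * enorm v)); last first.
  by rewrite ler_wpM2r ?enorm_ge0// lerDl.
rewrite /enorm -sqrtrM// ler_sqrt ?mulr_ge0 ?dot_ge0// dotE mulr_suml.
apply: ler_sum => i _; rewrite -expr2.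
rewrite (_ : (M *m v) i 0 = dot (row i M)^T v); last first.
  by rewrite /dot trmxK -row_mul [RHS]mxE.
have := @psd_cauchy_schwarz n 1%:M (row i M)^T v (trmx1 _ _).
rewrite !mul1mx => /(_ (fun w => ltac:(rewrite mul1mx; exact: dot_ge0))).
by rewrite mulrC.
Qed.

Lemma enorm_mulmx_le_opnorm m n (M : 'M[R]_(m, n)) v :
  enorm (M *m v) <= opnorm M * enorm v.
Proof.
have [->|v0] := eqVneq v 0; first by rewrite mulmx0 !enorm0 mulr0.
have v_gt0 : 0 < enorm v by rewrite lt_neqAle eq_sym enorm_eq0 v0 enorm_ge0.
rewrite -ler_pdivrMr//; apply: sup_upper_bound; last first.
  exists ((enorm v)^-1 *: v) => /=.
    by rewrite enormZ ger0_norm ?invr_ge0 ?(ltW v_gt0)// mulVf// ?gt_eqF.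
  by rewrite -scalemxAr enormZ ger0_norm ?invr_ge0 ?(ltW v_gt0)// mulrC.
(* The supremum defining [opnorm] is an upper bound only once its set is known to be nonempty and
   bounded. *)
split; first by exists (enorm (M *m 0)), 0 => //=; rewrite enorm0 ler01.
have [c c0 Mc] := mulmx_bounded M; exists c => _ [w /= w1 <-].
by rewrite (le_trans (Mc w))// ler_piMr// ltW.
Qed.

Lemma posdef_unitmx n (P : 'M[R]_n) : posdef P -> P \in unitmx.
Proof.
move=> [_ P0]; rewrite -unitmx_tr -row_free_unit -kermx_eq0.
apply/rowV0P => w /sub_kermxP wP; apply/eqP; apply: contraT => w0.
have := P0 w^T; rewrite -{1}(trmxK P) -trmx_mul wP trmx0.
rewrite dotC dot0l ltxx; apply.
by apply: contra w0 => /eqP wT; rewrite -(trmxK w) wT trmx0.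
Qed.

Lemma posdef_ge0 n (P : 'M[R]_n) v : posdef P -> 0 <= dot v (P *m v).
Proof.
move=> [_ P0]; have [->|/P0/ltW//] := eqVneq v 0.
by rewrite dot0l.
Qed.

(* Cauchy-Schwarz for the form [P] applied to [v] and [P^-1 v]. *)
Lemma posdef_coercive n (P : 'M[R]_n) : posdef P ->
  exists2 c, 0 < c & forall v : 'cV[R]_n, enorm v ^+ 2 <= c * dot v (P *m v).
Proof.
move=> Ppos; have [c c0 Pc] := mulmx_bounded (invmx P); exists c => // v.
have PPV w : P *m (invmx P *m w) = w by rewrite mulKVmx// posdef_unitmx.
have := @psd_cauchy_schwarz n P v (invmx P *m v) Ppos.1
  (fun w => posdef_ge0 w Ppos).
rewrite PPV -sqr_enorm => h.
have h' := cauchy_schwarz (invmx P *m v) v.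
have := Pc v; have := posdef_ge0 v Ppos; have := enorm_ge0 v.
move: h h'; set N := enorm v; set d := dot (invmx P *m v) v.
set V := dot v (P *m v); set w := enorm (invmx P *m v) => h h' N0 V0 wc.
have [->|Nn] := eqVneq N 0; first by rewrite expr0n/= mulr_ge0// ltW.
have Np : 0 < N ^+ 2 by rewrite exprn_gt0// lt_neqAle eq_sym Nn.
have dN : d <= c * N ^+ 2.
  by rewrite (le_trans h')// expr2 mulrA ler_wpM2r.
rewrite -(ler_pM2r Np) -expr2 (le_trans h)// mulrAC ler_wpM2r//.
Qed.

End euclidean.

(** * Derivatives and primitives *)

Section derivatives.
Context {R : realType}.
Implicit Types (m n : nat).

Lemma is_derive_mxP m n (M : R -> 'M[R]_(m, n)) (t : R) (dM : 'M[R]_(m, n)) :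
  is_derive t 1 M dM <-> forall i j, is_derive t 1 (fun s => M s i j) (dM i j).
Proof.
split => [[Md <-] i j|Mij].
  apply: DeriveDef; first exact: (proj1 (derivable_mxP M t 1) Md i j).
  by rewrite derive_mx// mxE.
have Md : derivable M t 1.
  by apply/(derivable_mxP M t 1) => i j; have [] := Mij i j.
apply: DeriveDef => //; rewrite derive_mx//; apply/matrixP => i j.
by rewrite mxE; have [] := Mij i j.
Qed.

Lemma is_derive_dot n (x y : traj R n) (t : R) (dx dy : 'cV[R]_n) :
  is_derive t 1 x dx -> is_derive t 1 y dy ->
  is_derive t 1 (fun s => dot (x s) (y s)) (dot dx (y t) + dot (x t) dy).
Proof.
move=> /is_derive_mxP dxij /is_derive_mxP dyij.
pose h (i : 'I_n) := (fun s => x s i 0) * (fun s => y s i 0).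
rewrite (_ : (fun s => _) = \sum_(i < n) h i); last first.
  by apply/funext => s; rewrite dotE fct_sumE.
rewrite !dotE -big_split /=; apply: is_derive_sum => i.
apply: (is_derive_eq (is_deriveM (dxij i 0) (dyij i 0))).
by rewrite addrC /GRing.scale/= mulrC [X in _ + X]mulrC.
Qed.

Lemma is_derive_mulmx m n (M : 'M[R]_(m, n)) (x : traj R n) (t : R) dx :
  is_derive t 1 x dx -> is_derive t 1 (fun s => M *m x s) (M *m dx).
Proof.
move=> xd; apply/is_derive_mxP => i j; rewrite ord1.
(* The product rule with a constant factor: [dot 0 (x t)] is the term of the derivative of the
   row. *)
have -> : (M *m dx) i 0 = dot 0 (x t) + dot (row i M)^T dx.
  by rewrite dot0l add0r /dot trmxK -row_mul [RHS]mxE.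
rewrite (_ : (fun s => _) = (fun s => dot (row i M)^T (x s))).
  exact: (@is_derive_dot _ (cst (row i M)^T)).
by apply/funext => s; rewrite /dot trmxK -row_mul [RHS]mxE.
Qed.

End derivatives.

Section primitives.
Context {R : realType}.
Notation mu := (@lebesgue_measure R).
Variable q : R -> R.
Hypothesis q_cont : continuous q.

Lemma continuous_integrable_itv (a b : R) : mu.-integrable `[a, b] (EFin \o q).
Proof.
apply: continuous_compact_integrable; first exact: segment_compact.
exact: continuous_subspaceT.
Qed.

Lemma is_derive_integral (t : R) : 0 < t ->
  is_derive t 1 (fun x => \int[mu]_(s in `[0, x]) q s) (q t).
Proof.
move=> t0.
(* Integrating up to t + 1 puts t in the interior, where the fundamental theorem gives a two-sided
   derivative. *)
have [] := @continuous_FTC1_closed R q 0 t (t + 1) ltac:(lra)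
  (continuous_integrable_itv 0 (t + 1)) t0 (@q_cont t).
by rewrite derive1E => qd <-; exact: DeriveDef.
Qed.

Lemma integral_increment_bound (M s t : R) : 0 <= s -> s <= t ->
  (forall z, 0 <= z <= t -> `|q z| <= M) ->
  `|\int[mu]_(z in `[0, t]) q z - \int[mu]_(z in `[0, s]) q z| <= M * (t - s).
Proof.
move=> s0 st qM.
have qint := continuous_integrable_itv.
rewrite Rintegral_itvB//.
have sub : `]s, t] `<=` `[0, t].
  move=> z /=; rewrite !in_itv/= => /andP[sz ->].
  by rewrite (le_trans s0 (ltW sz)).
have qint' : mu.-integrable `]s, t] (EFin \o q).
  by apply: integrableS (qint 0 t).
apply: le_trans (le_normr_Rintegral _ qint') _ => //.
have -> : M * (t - s) = \int[mu]_(z in `]s, t]) M.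
  rewrite Rintegral_cst//= lebesgue_measure_itv/= lte_fin.
  by case: ltgtP st => // -> _; rewrite subrr.
apply: le_Rintegral => //.
- exact: (integrable_norm qint').
- apply: integrableS (_ : mu.-integrable `[0, t] (EFin \o cst M)) => //.
  apply: continuous_compact_integrable; first exact: segment_compact.
  by apply: continuous_subspaceT => ?; exact: cvg_cst.
- by move=> z /sub; rewrite /= in_itv/= => /qM.
Qed.

Lemma continuous_bounded_itv (b : R) : 0 <= b ->
  exists2 M, 0 < M & forall z, 0 <= z <= b -> `|q z| <= M.
Proof.
move=> b0; have [|c _ cmax] := @EVT_max R (fun z => `|q z|) 0 b b0.
  by apply: continuous_subspaceT => z; apply: cvg_norm; exact: q_cont.
exists (`|q c| + 1) => [|z zb]; first by rewrite ltr_wpDl.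
by rewrite (le_trans (cmax z _)) ?in_itv//= lerDl.
Qed.

Hypothesis q_ge0 : forall t, 0 <= q t.

Lemma measurable_EFin_continuous D : measurable D ->
  measurable_fun D (EFin \o q).
Proof.
move=> mD; apply: measurableT_comp => //; apply: measurable_funTS.
exact: continuous_measurable_fun.
Qed.

(** Monotone convergence along the segments [0, i], with i a natural number. *)
Lemma integral_oy_le (r : R) :
  (forall t, 0 <= t -> \int[mu]_(s in `[0, t]) q s <= r) ->
  (\int[mu]_(s in `]0%R, +oo[) (q s)%:E <= r%:E)%E.
Proof.
move=> qr; rewrite integral_itv_obnd_cbnd; last first.
  exact: measurable_EFin_continuous.
rewrite itv_bndy_bigcup_BRight.
have : (\int[mu]_(s in `[0%R, (0 + i%:R)%R]%classic) (q s)%:E @[i --> \oo] -->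
    \int[mu]_(s in \bigcup_i `[0%R, (0 + i%:R)%R]%classic) (q s)%:E)%E.
  apply: ge0_nondecreasing_set_cvg_integral => //.
  - move=> i j ij; rewrite subsetEset; apply: subset_itvl.
    by rewrite bnd_simp lerD2l ler_nat.
  - by move=> i; exact: measurable_EFin_continuous.
  - by move=> i x _; rewrite lee_fin.
move=> /cvg_lim <-//; apply: lime_le.
  apply: ereal_nondecreasing_is_cvgn => i j ij.
  apply: ge0_subset_integral => //.
  - exact: measurable_EFin_continuous.
  - by move=> x _; rewrite lee_fin.
  - by apply: subset_itvl; rewrite bnd_simp lerD2l ler_nat.
apply: nearW => i; rewrite add0r.
rewrite -(@fineK _ (integral _ _ _)) ?lee_fin; first exact: qr.
exact/integrable_fin_num/continuous_integrable_itv.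
Qed.

Lemma integral_itv_le_oy (t : R) :
  ((\int[mu]_(s in `[0, t]) q s)%:E <= \int[mu]_(s in `]0%R, +oo[) (q s)%:E)%E.
Proof.
rewrite /Rintegral fineK; last first.
  exact/integrable_fin_num/continuous_integrable_itv.
rewrite [leRHS]integral_itv_obnd_cbnd; last exact: measurable_EFin_continuous.
apply: ge0_subset_integral => //.
- exact: measurable_EFin_continuous.
- by move=> x _; rewrite lee_fin.
- exact: subset_itvl.
Qed.

End primitives.

(** * Trajectories *)

Section trajectories.
Context {R : realType}.
Notation mu := (@lebesgue_measure R).

Lemma L2normE n (g : traj R n) :
  L2norm g = ((\int[mu]_(t in `]0%R, +oo[) (enorm (g t) ^+ 2)%:E) `^ 2^-1)%E.
Proof.
rewrite /L2norm unlock [in RHS]integral_mkcond; congr poweR.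
apply: eq_integral => t _ /=; rewrite !patchE; case: ifP => _ /=.
  by rewrite ger0_norm ?enorm_ge0// powR_mulrn// enorm_ge0.
by rewrite normr0 powR0// pnatr_eq0.
Qed.

Lemma loc_abs_continuousB n (x y : traj R n) :
  loc_abs_continuous x -> loc_abs_continuous y ->
  loc_abs_continuous (fun t => x t - y t).
Proof.
move=> xac yac b b0 eps eps0.
have e20 : 0 < eps / 2 by rewrite divr_gt0.
have [d d0 xd] := xac b b0 _ e20; have [d' d'0 yd] := yac b b0 _ e20.
exists (Num.min d d') => [|k I Ib Itriv]; first by rewrite lt_min d0.
rewrite lt_min => /andP[Id Id'].
rewrite [ltRHS]splitr; apply: le_lt_trans (ltrD (xd k I Ib Itriv Id)
  (yd k I Ib Itriv Id')).
rewrite -big_split; apply: ler_sum => i _ /=.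
rewrite (_ : _ - _ = (x (I i).2 - x (I i).1) + - (y (I i).2 - y (I i).1)).
  by rewrite (le_trans (ler_enormD _ _))// enormN.
by apply/matrixP => j l; rewrite !mxE; ring.
Qed.

(** Absolute continuity tested on a single interval. Nothing is known of a trajectory at negative
    times, so [Num.max 0 t] freezes it there at its initial value; this yields continuity on the
    whole line, as the results on primitives require. *)
Lemma loc_abs_continuous_enorm n (x : traj R n) : loc_abs_continuous x ->
  continuous (fun t : R => enorm (x (Num.max 0 t))).
Proof.
move=> xac t; apply/cvgrPdist_lt => eps eps0.
(* This horizon contains every nonnegative time within distance 1 of t, whence the radius
   [Num.min 1 d] below. *)
have [d d0 xd] := xac (`|t| + 1) ltac:(by rewrite addr_ge0) _ eps0.
have mono s s' : 0 <= s -> s <= s' -> s' <= `|t| + 1 -> s' - s < d ->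
    enorm (x s' - x s) < eps.
  move=> s0 ss' s't sd; have := xd 1 (fun=> (s, s')); rewrite !big_ord1.
  by apply => //; apply/trivIsetP => i j _ _; rewrite !ord1 eqxx.
exists (Num.min 1 d) => /=; first by rewrite lt_min d0 ltr01.
move=> s /=; rewrite lt_min => /andP[st1 std].
apply: le_lt_trans (ler_dist_enorm _ _) _.
have t1 := ler_norm t; have t0 := normr_ge0 t.
move: st1 std; rewrite !ltr_distl => /andP[? ?] /andP[? ?].
have max_le z : z <= `|t| + 1 -> Num.max 0 z <= `|t| + 1.
  by move=> ?; rewrite ge_max addr_ge0//.
have max_ge (z : R) : 0 <= Num.max 0 z by rewrite le_max lexx.
have max_homo (z z' : R) : z <= z' -> Num.max 0 z <= Num.max 0 z'.
  by move=> zz'; rewrite ge_max !le_max lexx zz' orbT.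
have [st|/ltW ts] := leP s t.
  apply: mono; [exact: max_ge|exact: max_homo|apply: max_le; lra|].
  by case: (leP 0 t); case: (leP 0 s); lra.
rewrite -opprB enormN.
apply: mono; [exact: max_ge|exact: max_homo|apply: max_le; lra|].
by case: (leP 0 t); case: (leP 0 s); lra.
Qed.

Lemma within_continuous_sqr_enorm n (x : R -> 'cV[R]_n) :
  {within `[0, +oo[, continuous x} ->
  continuous (fun t : R => enorm (x (Num.max 0 t)) ^+ 2).
Proof.
move=> /subspace_continuousP xc t.
have xmax : x (Num.max 0 s) @[s --> t] --> x (Num.max 0 t).
  have m0 (s : R) : `[0, +oo[%classic (Num.max 0 s).
    by rewrite /= in_itv/= le_max lexx.
  (* Continuity within the half-line suffices, since [Num.max 0 s] never leaves it. *)
  apply: cvg_trans (xc _ (m0 t)) => A /= xA.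
  have maxc : Num.max 0 s @[s --> t] --> Num.max 0 t.
    exact: (@continuous_max R R (cst 0) id t (cvg_cst _) cvg_id).
  apply: (@filterS _ (nbhs t) _ (fun s => `[0, +oo[%classic (Num.max 0 s) ->
    A (x (Num.max 0 s)))); last exact: (maxc _ xA).
  by move=> s; apply; exact: m0.
rewrite /continuous_at sqr_enorm dotE.
under eq_fun do rewrite sqr_enorm dotE.
have xi i : x (Num.max 0 s) i 0 @[s --> t] --> x (Num.max 0 t) i 0.
  exact: (cvg_comp _ _ xmax (@coord_continuous _ _ _ i 0 _)).
suff sumc (r : seq 'I_n) :
    \sum_(i <- r) x (Num.max 0 s) i 0 * x (Num.max 0 s) i 0 @[s --> t] -->
    \sum_(i <- r) x (Num.max 0 t) i 0 * x (Num.max 0 t) i 0 by exact: sumc.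
elim: r => [|i r IHr].
  rewrite big_nil (_ : (fun s => _) = cst 0); first exact: cvg_cst.
  by apply/funext => s; rewrite big_nil.
rewrite big_cons (_ : (fun s => _) = fun s : R =>
  x (Num.max 0 s) i 0 * x (Num.max 0 s) i 0 +
  \sum_(i <- r) x (Num.max 0 s) i 0 * x (Num.max 0 s) i 0).
  by apply: cvgD IHr; apply: cvgM; exact: xi.
by apply/funext => s; rewrite big_cons.
Qed.

End trajectories.

(** * Integration of a dissipation inequality *)

(** A stand-in for absolute continuity of functions built from [e]: it is the hypothesis of
    [abs_continuous_ae_derive_le0], and it is stable under sums, scaling and products of bounded
    functions. *)
Definition lip_along {R : realType} {n : nat} (e : traj R n) (b : R)
    (g : R -> R) : Prop :=
  exists2 M, 0 <= M & forall s t, 0 <= s -> s <= t -> t <= b ->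
    `|g t - g s| <= M * (enorm (e t - e s) + (t - s)).

Section lip_along_theory.
Context {R : realType} {n : nat} (e : traj R n) (b : R).

Lemma lip_alongD (g h : R -> R) : lip_along e b g -> lip_along e b h ->
  lip_along e b (fun t => g t + h t).
Proof.
move=> [M M0 gM] [N N0 hN]; exists (M + N) => [|s t s0 st tb].
  by rewrite addr_ge0.
rewrite mulrDl; apply: le_trans (lerD (gM s t s0 st tb) (hN s t s0 st tb)).
by rewrite opprD addrACA ler_normD.
Qed.

Lemma lip_alongZ (c : R) (g : R -> R) : lip_along e b g ->
  lip_along e b (fun t => c * g t).
Proof.
move=> [M M0 gM]; exists (`|c| * M) => [|s t s0 st tb].
  by rewrite mulr_ge0.
by rewrite -mulrBr normrM -mulrA ler_wpM2l// gM.
Qed.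

Lemma lip_alongM (G H : R) (g h : R -> R) : 0 <= G -> 0 <= H ->
  (forall t, 0 <= t <= b -> `|g t| <= G) ->
  (forall t, 0 <= t <= b -> `|h t| <= H) ->
  lip_along e b g -> lip_along e b h -> lip_along e b (fun t => g t * h t).
Proof.
move=> G0 H0 gG hH [M M0 gM] [N N0 hN].
exists (M * H + N * G) => [|s t s0 st tb].
  by rewrite addr_ge0// mulr_ge0.
have -> : g t * h t - g s * h s = (g t - g s) * h t + (h t - h s) * g s by ring.
apply: le_trans (ler_normD _ _) _; rewrite !normrM mulrDl.
rewrite lerD// mulrAC ler_pM//.
- exact: gM.
- by apply: hH; rewrite tb (le_trans s0).
- exact: hN.
- by apply: gG; rewrite s0 (le_trans st).
Qed.

Lemma lip_along_expR (a : R) : 0 <= a -> lip_along e b (fun t => expR (a * t)).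
Proof.
move=> a0; exists (a * expR (a * b)) => [|s t s0 st tb].
  by rewrite mulr_ge0// expR_ge0.
have es : expR (a * s) <= expR (a * t) by rewrite ler_expR ler_wpM2l.
have et : expR (a * t) <= expR (a * b) by rewrite ler_expR ler_wpM2l.
rewrite ger0_norm ?subr_ge0//.
(* The tangent inequality 1 + y <= exp y at y = - a (t - s). *)
have : expR (a * t) * (1 - a * (t - s)) <= expR (a * s).
  have -> : a * s = a * t + - (a * (t - s)) by ring.
  by rewrite expRD ler_pM2l ?expR_gt0// expR_ge1Dx.
have ts : 0 <= a * (t - s) by rewrite mulr_ge0// subr_ge0.
have : expR (a * t) * (a * (t - s)) <= expR (a * b) * (a * (t - s)).
  by rewrite ler_wpM2r.
have : 0 <= a * expR (a * b) * enorm (e t - e s).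
  by rewrite !mulr_ge0 ?expR_ge0 ?enorm_ge0.
by rewrite !mulrDr mulr1; lra.
Qed.

Lemma lip_along_integral (q : R -> R) : 0 <= b -> continuous q ->
  lip_along e b (fun t => \int[@lebesgue_measure R]_(s in `[0, t]) q s).
Proof.
move=> b0 qc; have [M M0 qM] := continuous_bounded_itv qc b0.
exists M => [|s t s0 st tb]; first exact: ltW.
apply: le_trans (integral_increment_bound qc s0 st _) _.
  by move=> z /andP[z0 zt]; apply: qM; rewrite z0 (le_trans zt).
by rewrite ler_pM2l// lerDr enorm_ge0.
Qed.

Lemma lip_along_quadratic (P : 'M[R]_n) (B : R) : P^T = P -> 0 <= B ->
  (forall t, 0 <= t <= b -> enorm (e t) <= B) ->
  lip_along e b (fun t => dot (e t) (P *m e t)).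
Proof.
move=> PT B0 eB; have [c c0 Pc] := mulmx_bounded P.
exists (c * (B + B)) => [|s t s0 st tb].
  by rewrite mulr_ge0 ?addr_ge0// ltW.
(* A difference of two squares, factored thanks to the symmetry of P. *)
have -> : dot (e t) (P *m e t) - dot (e s) (P *m e s) =
    dot (P *m (e t + e s)) (e t - e s).
  rewrite (_ : dot (P *m _) _ = dot (e t + e s) (P *m (e t - e s))); last first.
    by rewrite (dot_mulmx P (e t + e s)) PT.
  rewrite mulmxBr dotDl !dotBr [dot (e s) (P *m e t)]dot_mulmx PT.
  by rewrite [dot (P *m e s) _]dotC; ring.
apply: (@le_trans _ _ (enorm (P *m (e t + e s)) * enorm (e t - e s))).
  rewrite ler_norml cauchy_schwarz andbT lerNl -dotNl.
  by rewrite (le_trans (cauchy_schwarz _ _))// enormN.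
apply: ler_pM; rewrite ?enorm_ge0//; last by rewrite lerDl subr_ge0.
apply: le_trans (Pc _) _; rewrite ler_pM2l//.
apply: le_trans (ler_enormD _ _) _; rewrite lerD// eB//.
  by rewrite tb (le_trans s0).
by rewrite s0 (le_trans st).
Qed.

Lemma lip_along_nonincreasing (g : R -> R) : 0 <= b ->
  loc_abs_continuous e -> lip_along e b g ->
  {ae @lebesgue_measure R, forall t : R, 0 < t ->
     exists2 d, is_derive t 1 g d & d <= 0} ->
  g b <= g 0.
Proof.
move=> b0 eac [M M0 gM] gae.
apply: (@abs_continuous_ae_derive_le0 _ _ 0 b (M + 1) e g b0) => //.
- by rewrite ltr_wpDl.
- exact: eac.
- move=> s t s0 st tb; apply: le_trans (gM s t s0 st tb) _.
  by rewrite ler_wpM2r ?lerDl// addr_ge0 ?enorm_ge0// subr_ge0.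
(* The primitives from 0 are differentiated only at positive times; the single point 0 is a null
   set. *)
have ae0 : {ae @lebesgue_measure R, forall t : R, t != 0}.
  exists [set 0]; split => //; first exact: lebesgue_measure_set1.
  by move=> t /= /negP; rewrite negbK => /eqP.
apply: (@filterS2 _ _ (ae_filter_ringOfSetsType _)) gae ae0.
move=> t gt t0 /andP[t_ge0 _]; apply: gt.
by rewrite lt_neqAle eq_sym t0.
Qed.

End lip_along_theory.

Section dissipation.
Context {R : realType} {n : nat} (P : 'M[R]_n) (e : traj R n) (w : R -> R).
Variables (alpha c K : R).
Hypotheses (P_posdef : posdef P) (e_ac : loc_abs_continuous e).
Hypotheses (w_cont : continuous w) (w_ge0 : forall t, 0 <= w t).
Hypotheses (alpha_ge0 : 0 <= alpha) (c_ge0 : 0 <= c).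
Hypothesis dissipative : {ae @lebesgue_measure R, forall t : R, 0 < t ->
  exists2 de, is_derive t 1 e de &
    2 * dot (e t) (P *m de) <= - alpha * enorm (e t) ^+ 2 + c * w t}.

Let V (t : R) := dot (e t) (P *m e t).
Let J (t : R) := \int[@lebesgue_measure R]_(s in `[0, t]) w s.

Let enorm_e_cont := loc_abs_continuous_enorm e_ac.

Let e_bounded b : 0 <= b ->
  exists2 B, 0 <= B & forall t, 0 <= t <= b -> enorm (e t) <= B.
Proof.
move=> b0; have [B B0 eB] := continuous_bounded_itv enorm_e_cont b0.
exists B; first exact: ltW.
move=> t tb; have := eB t tb; rewrite ger0_norm ?enorm_ge0//.
by move/andP: tb => [t0 _]; rewrite max_r.
Qed.

Let lip_V b : 0 <= b -> lip_along e b V.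
Proof.
move=> b0; have [B B0 eB] := e_bounded b0.
exact: lip_along_quadratic P_posdef.1 B0 eB.
Qed.

Let is_derive_V (t : R) de : is_derive t 1 e de ->
  is_derive t 1 V (2 * dot (e t) (P *m de)).
Proof.
move=> ed; apply: (is_derive_eq (is_derive_dot ed (is_derive_mulmx P ed))).
by rewrite (dot_mulmx P de) P_posdef.1 [dot (P *m de) _]dotC; ring.
Qed.

Lemma dissipation_integral b : 0 <= b ->
  dot (e b) (P *m e b) + alpha * \int[@lebesgue_measure R]_(s in `[0, b])
    enorm (e (Num.max 0 s)) ^+ 2 <=
  dot (e 0) (P *m e 0) + c * \int[@lebesgue_measure R]_(s in `[0, b]) w s.
Proof.
move=> b0; rewrite -/(V b) -/(V 0) -/(J b).
have qc : continuous (fun t : R => enorm (e (Num.max 0 t)) ^+ 2).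
  by move=> t; apply: cvgM; exact: enorm_e_cont.
pose g (t : R) := (V t + alpha * \int[@lebesgue_measure R]_(s in `[0, t])
    enorm (e (Num.max 0 s)) ^+ 2) + (- c) * J t.
suff : g b <= g 0.
  rewrite /g /J !set_itv1 !Rintegral_set1 !mulr0 !addr0; lra.
apply: (lip_along_nonincreasing b0 e_ac).
  apply: lip_alongD; last exact/lip_alongZ/lip_along_integral.
  by apply: lip_alongD; [exact: lip_V | exact/lip_alongZ/lip_along_integral].
apply: (@filterS _ _ (ae_filter_ringOfSetsType _)) dissipative => t et t0.
have [de ed deV] := et t0.
exists ((2 * dot (e t) (P *m de) + alpha * enorm (e (Num.max 0 t)) ^+ 2)
    + (- c) * w t).
  apply: is_deriveD; last first.
    exact: (is_deriveZ (- c) (is_derive_integral w_cont t0)).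
  apply: is_deriveD; first exact: is_derive_V.
  exact: (is_deriveZ alpha (is_derive_integral qc t0)).
by rewrite (max_r (ltW t0)); lra.
Qed.

(** With a = alpha / K the upper bound on the form gives a V <= alpha |e|^2, so exp(a t) (V - c J)
    is nonincreasing; the additional term - a c J of its derivative has the right sign because J >=
    0. *)
Lemma dissipation_exponential b : 0 <= b -> 0 < K ->
  (forall v, dot v (P *m v) <= K * enorm v ^+ 2) ->
  dot (e b) (P *m e b) <= dot (e 0) (P *m e 0) * expR (- (alpha / K * b)) +
    c * \int[@lebesgue_measure R]_(s in `[0, b]) w s.
Proof.
move=> b0 K0 PK; rewrite -/(V b) -/(V 0) -/(J b); set a := alpha / K.
have a0 : 0 <= a by rewrite divr_ge0// ltW.
pose h t := V t + (- c) * J t.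
pose g t := expR (a * t) * h t.
suff : g b <= g 0.
  rewrite /g /h /J mulr0 expR0 mul1r set_itv1 Rintegral_set1 mulr0 addr0.
  by rewrite expRN -lerBlDr ler_pdivlMr ?expR_gt0// mulrC mulNr.
have lip_h : lip_along e b h.
  by apply: lip_alongD; [exact: lip_V|exact/lip_alongZ/lip_along_integral].
(* The product rule for [lip_along] asks for bounded factors; the bound on [h] follows from its own
   increments starting at time 0. *)
have [B B0 hB] : exists2 B, 0 <= B & forall t, 0 <= t <= b -> `|h t| <= B.
  have [M M0 hM] := lip_h; have [B B0 eB] := e_bounded b0.
  exists (`|h 0| + M * ((B + B) + b)) => [|t tb].
    by rewrite addr_ge0// mulr_ge0// !addr_ge0.
  rewrite -(subrK (h 0) (h t)) addrC (le_trans (ler_normD _ _))// lerD2l.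
  move: (tb) => /andP[t0 tb']; apply: le_trans (hM _ _ _ t0 tb') _ => //.
  rewrite ler_wpM2l// subr0 lerD// (le_trans (ler_enormD _ _))// enormN lerD//.
    exact: eB.
  by apply: eB; rewrite lexx.
apply: (lip_along_nonincreasing b0 e_ac).
  apply: (@lip_alongM _ _ _ _ (expR (a * b)) B) => //.
  - move=> t /andP[_ tb]; rewrite ger0_norm ?expR_ge0// ler_expR.
    by rewrite ler_wpM2l.
  - exact: lip_along_expR.
apply: (@filterS _ _ (ae_filter_ringOfSetsType _)) dissipative => t et t0.
have [de ed deV] := et t0.
have hd : is_derive t 1 h (2 * dot (e t) (P *m de) + (- c) * w t).
  apply: is_deriveD; first exact: is_derive_V.
  exact: (is_deriveZ (- c) (is_derive_integral w_cont t0)).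
have expd : is_derive t 1 (fun t => expR (a * t)) (a * expR (a * t)).
  have ad := is_deriveZ a (is_derive_id t (1 : R)).
  apply: (is_derive_eq (is_derive1_comp (is_derive_expR (a * t)) ad)).
  by rewrite /GRing.scale/= mulr1 mulrC.
exists (expR (a * t) * ((2 * dot (e t) (P *m de) + (- c) * w t) + a * h t)).
  by apply: (is_derive_eq (is_deriveM expd hd)); rewrite /GRing.scale/=; ring.
rewrite pmulr_rle0 ?expR_gt0//.
have aV : a * V t <= alpha * enorm (e t) ^+ 2.
  apply: le_trans (ler_wpM2l a0 (PK (e t))) _.
  by rewrite /a mulrA mulfVK// gt_eqF.
have : 0 <= a * (c * J t).
  by apply: mulr_ge0 => //; apply: mulr_ge0 => //; exact: Rintegral_ge0.
by rewrite /h; lra.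
Qed.

End dissipation.

(** * Dissipation along the estimation error *)

Lemma sqrtrD_le {R : rcfType} (a b : R) : 0 <= a -> 0 <= b ->
  Num.sqrt (a + b) <= Num.sqrt a + Num.sqrt b.
Proof.
move=> a0 b0; rewrite -(@ler_pXn2r _ 2)// ?nnegrE ?addr_ge0 ?sqrtr_ge0//.
rewrite sqrrD !sqr_sqrtr ?addr_ge0//.
by have := mulr_ge0 (sqrtr_ge0 a) (sqrtr_ge0 b); lra.
Qed.

Section sliding_mode_dissipation.
Context {R : realType} {n m p r : nat}.
Variables (A : 'M[R]_n) (B : 'M[R]_(n, m)) (C : 'M[R]_(m, n)).
Variables (F : 'M[R]_(p, n)) (calF : 'cV[R]_m -> set 'cV[R]_m).
Variables (f : 'cV[R]_n -> 'cV[R]_r -> 'cV[R]_n).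
Variables (Lf eps delta : R) (P : 'M[R]_n) (L : 'M[R]_(n, p)).
Variable K : 'M[R]_(m, p).
Hypotheses (calF_mono : Defs.monotone calF) (eps_gt0 : 0 < eps).
Hypothesis f_lip :
  forall x1 x2 v, enorm (f x1 v - f x2 v) <= Lf * enorm (x1 - x2).
Hypotheses (P_posdef : posdef P) (lmi : neg_semidef (lmi_mx A F P L Lf eps)).
Hypotheses (BP : B^T *m P = C - K *m F) (delta_gt0 : 0 < delta).

(** By symmetry of P, the two transposed products of the matrix inequality contribute equally to its
    quadratic form. *)
Lemma lmi_dissipation (e : 'cV[R]_n) :
  2 * dot e (P *m ((A - L *m F) *m e)) <=
    - (2 * Lf * opnorm P) * enorm e ^+ 2 - 2 * eps * enorm e ^+ 2.
Proof.
have [_ /(_ e)] := lmi; rewrite /lmi_mx; move: (A - L *m F) => M.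
rewrite !mulmxDl !mul_scalar_mx !dotDr !dotZr -!sqr_enorm -!mulmxA.
rewrite [dot e (M^T *m _)]dot_mulmx trmxK [dot (M *m e) _]dotC.
by rewrite (dot_mulmx P e (M *m e)) P_posdef.1; lra.
Qed.

Lemma dot_lipschitz_le (x xt : 'cV[R]_n) v :
  dot (xt - x) (P *m (f xt v - f x v)) <= Lf * opnorm P * enorm (xt - x) ^+ 2.
Proof.
rewrite dot_mulmx P_posdef.1; apply: le_trans (cauchy_schwarz _ _) _.
rewrite (_ : Lf * _ * _ = (opnorm P * enorm (xt - x)) * (Lf * enorm (xt - x))).
  by rewrite ler_pM ?enorm_ge0// enorm_mulmx_le_opnorm.
by ring.
Qed.

(** The relation between B^T P and C - K F makes B^T P (xt - x) the difference of the two arguments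
    of [calF], so monotonicity applies. *)
Lemma dot_monotone_le0 (x xt : 'cV[R]_n) (om omt : 'cV[R]_m) :
  calF (C *m x) (- om) -> calF (C *m xt - K *m (F *m (xt - x))) (- omt) ->
  dot (xt - x) (P *m (B *m (omt - om))) <= 0.
Proof.
move=> xom xtomt; rewrite dot_mulmx P_posdef.1 dot_mulmx mulmxA BP.
have := calF_mono xtomt xom.
rewrite mulmxBl -mulmxA (mulmxBr C).
rewrite (_ : - omt - - om = - (omt - om)); last by rewrite opprB addrC opprK.
by rewrite dotNl oppr_ge0 dotC addrAC.
Qed.

(** For nonzero z the product of z and s is |z|, and Cauchy-Schwarz bounds the other term by k1 |z|;
    at z = 0 both products vanish, whatever s is chosen in the ball. *)
Lemma dot_Sign_ge0 (z s xi1 : 'cV[R]_p) (k1 : R) :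
  Sign z s -> enorm xi1 <= k1 -> 0 <= k1 * dot z s + dot z xi1.
Proof.
rewrite /Sign; case: eqVneq => [-> _ _|z0 /= -> xi1k].
  by rewrite !dot0l mulr0 addr0.
have z_gt0 : 0 < enorm z by rewrite lt_neqAle eq_sym enorm_eq0 z0 enorm_ge0.
rewrite dotZr -sqr_enorm expr2 mulKf ?gt_eqF//.
have := cauchy_schwarz (- z) xi1; rewrite dotNl enormN => h.
by have := ler_wpM2l (ltW z_gt0) xi1k; lra.
Qed.

Lemma error_dissipation (cP k1 k3 : R) (x xt de : 'cV[R]_n)
    (om omt : 'cV[R]_m) v (s xi1 : 'cV[R]_p) (xi xi2 : 'cV[R]_n) :
  0 <= k3 -> 0 <= cP -> (forall z : 'cV[R]_n, enorm (P *m z) <= cP * enorm z) ->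
  calF (C *m x) (- om) -> calF (C *m xt - K *m (F *m (xt - x))) (- omt) ->
  Sign (F *m (xt - x)) s -> enorm xi1 <= k1 ->
  xi = invmx P *m F^T *m xi1 + xi2 -> enorm xi2 <= enorm xi ->
  de = (A *m xt + B *m omt - L *m (F *m (xt - x)) + f xt v
        - (invmx P *m F^T) *m (k1 *: s
             + (k3 / (enorm (F *m (xt - x)) ^+ 2 + delta)) *: (F *m (xt - x))))
       - (A *m x + B *m om + f x v + xi) ->
  2 * dot (xt - x) (P *m de) <=
    - eps * enorm (xt - x) ^+ 2 + cP ^+ 2 / eps * enorm xi ^+ 2.
Proof.
move=> k30 cP0 Pc xom xtomt zs xi1k xiE xi2le deE.
have lmiE := lmi_dissipation (xt - x).
have fE := dot_lipschitz_le x xt v.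
have omE := dot_monotone_le0 xom xtomt.
set e := xt - x in lmiE fE omE zs deE *; set z := F *m e in zs deE *.
have signE := dot_Sign_ge0 zs xi1k.
set k := k3 / _ in deE.
have k_ge0 : 0 <= k by rewrite divr_ge0// addr_ge0 ?sqr_ge0// ltW.
(* The factor P^-1 F^T makes every correction term act on the error through the measured quantity z
   = F e alone. *)
have PiF y : dot e (P *m (invmx P *m F^T *m y)) = dot z y.
  by rewrite !mulmxA mulmxV ?posdef_unitmx// mul1mx dot_mulmx trmxK.
have -> : dot e (P *m de) = dot e (P *m ((A - L *m F) *m e))
    + dot e (P *m (B *m (omt - om))) + dot e (P *m (f xt v - f x v))
    - (k1 * dot z s + dot z xi1) - k * dot z z - dot e (P *m xi2).
  have -> : de = (A - L *m F) *m e + B *m (omt - om) + (f xt v - f x v)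
      - invmx P *m F^T *m (k1 *: s + k *: z + xi1) - xi2.
    rewrite deE xiE mulmxBl -(mulmxA L) -/z (mulmxBr A) (mulmxBr B).
    move: (invmx P *m F^T) => Q; rewrite !(mulmxDr Q).
    (* With the products made opaque, the identity is linear in each entry. *)
    move: (A *m xt) (A *m x) (B *m omt) (B *m om) (L *m z) => a1 a2 b1 b2 l.
    move: (Q *m _) (Q *m _) (Q *m _) => q1 q2 q3.
    by apply/matrixP => i j; rewrite !mxE; ring.
  by rewrite !(mulmxDr P) !(mulmxN P) !dotDr !dotNr PiF !dotDr !dotZr; ring.
(* Young's inequality, spending one [eps] of the margin 2 eps in the matrix inequality; the other
   one remains as decay rate. *)
have xi2E : - (2 * dot e (P *m xi2)) <=
    eps * enorm e ^+ 2 + cP ^+ 2 / eps * enorm xi ^+ 2.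
  rewrite -mulrN -dotNr -mulmxN.
  have h1 : dot e (P *m - xi2) <= enorm e * (cP * enorm xi).
    apply: le_trans (cauchy_schwarz _ _) _; rewrite ler_wpM2l ?enorm_ge0//.
    by apply: le_trans (Pc _) _; rewrite enormN ler_wpM2l.
  have -> : cP ^+ 2 / eps * enorm xi ^+ 2 = eps * (cP / eps * enorm xi) ^+ 2.
    by field; rewrite gt_eqF.
  have cPE : cP * enorm xi = eps * (cP / eps * enorm xi).
    by field; rewrite gt_eqF.
  rewrite cPE in h1.
  have := mulr_ge0 (ltW eps_gt0) (sqr_ge0 (enorm e - cP / eps * enorm xi)).
  by rewrite sqrrB; lra.
have zz : 0 <= k * dot z z by rewrite mulr_ge0// dot_ge0.
by lra.
Qed.

End sliding_mode_dissipation.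

(** * Bounds on the estimation error *)

(** Pythagoras: w lies in S, so the residual v2 is orthogonal to it. *)
Lemma enorm_orthogonal_projection {R : realType} {n : nat} (S : set 'cV[R]_n)
    (v w v2 : 'cV[R]_n) :
  orthogonal_projection S v w -> v = w + v2 -> enorm v2 <= enorm v.
Proof.
move=> [Sw /(_ w Sw)] + vE; rewrite {1}vE addrAC subrr add0r => v2w.
rewrite -(@ler_pXn2r _ 2)// ?nnegrE ?enorm_ge0// !sqr_enorm.
rewrite vE dotDl !dotDr (dotC w v2) v2w.
by have := dot_ge0 w; lra.
Qed.

(** Transfers Euclidean decay of the error to convergence in the topology of the sup norm. *)
Lemma ler_mxnorm_enorm {R : realType} {n : nat} (v : 'cV[R]_n) :
  `|v| <= enorm v.
Proof.
rewrite [leLHS]/Num.Def.normr/= mx_normrE.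
rewrite (bigmax_le _ (enorm_ge0 v))//= => -[i j] _.
by rewrite ord1; exact: ler_coord_enorm.
Qed.

Section sliding_observer_errors.
Context {R : realType} {n m p r : nat}.
Variables (A : 'M[R]_n) (B : 'M[R]_(n, m)) (C : 'M[R]_(m, n)).
Variables (F : 'M[R]_(p, n)) (calF : 'cV[R]_m -> set 'cV[R]_m).
Variables (f : 'cV[R]_n -> 'cV[R]_r -> 'cV[R]_n) (u : R -> 'cV[R]_r).
Variables (Lf eps delta : R) (P : 'M[R]_n) (L : 'M[R]_(n, p)).
Variables (K : 'M[R]_(m, p)) (kappa1 kappa2 kappa3 : R -> R).
Hypotheses (calF_mono : Defs.monotone calF) (eps_gt0 : 0 < eps).
Hypothesis f_lip :
  forall x1 x2 v, enorm (f x1 v - f x2 v) <= Lf * enorm (x1 - x2).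
Hypotheses (P_posdef : posdef P) (lmi : neg_semidef (lmi_mx A F P L Lf eps)).
Hypotheses (BP : B^T *m P = C - K *m F) (delta_gt0 : 0 < delta).
Hypothesis kappa3_ge0 : forall t : R, 0 <= t -> 0 <= kappa3 t.

Notation mu := (@lebesgue_measure R).
Notation sys := (lure_system A B C F calF f u).
Notation obs := (sliding_observer A B C F calF f u P L K kappa1 kappa3 delta).
Notation W := (admissible_uncertainty F P kappa1 kappa2).

Lemma errors_abs_continuous xi e : errors sys obs xi e -> loc_abs_continuous e.
Proof.
by move=> [x [y [xt [[xac _ _] [xtac _] ->]]]]; exact: loc_abs_continuousB.
Qed.

Lemma errors_dissipative (cP : R) xi e : 0 <= cP ->
  (forall z : 'cV[R]_n, enorm (P *m z) <= cP * enorm z) ->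
  W xi -> errors sys obs xi e ->
  {ae mu, forall t : R, 0 < t -> exists2 de, is_derive t 1 e de &
    2 * dot (e t) (P *m de) <= - eps * enorm (e t) ^+ 2 +
      cP ^+ 2 / eps * enorm (xi (Num.max 0 t)) ^+ 2}.
Proof.
move=> cP0 Pc [_ [xi1 [xi2 xiP]]].
move=> [x [y [xt [[_ /= yE [om omP]] [_ [omt omtP]] ->]]]].
apply: (@filterS2 _ _ (ae_filter_ringOfSetsType mu) _ _ _ _ omP omtP).
move=> t + + t0; have t0' := ltW t0; rewrite (max_r t0').
move=> /(_ t0')[xd xom] /(_ t0')[[s]].
have [xiE xiproj xi1k _] := xiP t t0'.
rewrite (yE t t0') -mulmxBr => zs xtd xtom.
exists (A *m xt t + B *m omt t - L *m (F *m (xt t - x t)) + f (xt t) (u t)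
        - (invmx P *m F^T) *m (kappa1 t *: s
             + (kappa3 t / (enorm (F *m (xt t - x t)) ^+ 2 + delta)) *:
                 (F *m (xt t - x t)))
       - (A *m x t + B *m om t + f (x t) (u t) + xi t)).
  exact: is_deriveB.
exact: (error_dissipation calF_mono eps_gt0 f_lip P_posdef lmi BP delta_gt0
  (kappa3_ge0 t0') cP0 Pc xom xtom zs xi1k xiE
  (enorm_orthogonal_projection xiproj xiE) erefl).
Qed.

(** Lets stability of the undisturbed error be read off the bounds for admissible disturbances. *)
Lemma admissible_uncertainty0 :
  (forall t, 0 <= t -> 0 <= kappa1 t) -> (forall t, 0 <= t -> 0 <= kappa2 t) ->
  W (fun=> 0).
Proof.
move=> k1 k2; split.
  by apply: continuous_subspaceT => t; exact: cvg_cst.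
exists (fun=> 0), (fun=> 0) => t t0; rewrite mulmx0 addr0 !enorm0.
split; rewrite ?k1 ?k2//.
split; first by exists 0 => //; rewrite mulmx0.
by move=> z _; rewrite subr0 dot0l.
Qed.

Variables (M Q : R).
Hypotheses (M_gt0 : 0 < M) (Q_gt0 : 0 < Q).
Hypothesis P_coercive : forall v, enorm v ^+ 2 <= M * dot v (P *m v).
Hypothesis P_bounded : forall v, enorm (P *m v) <= Q * enorm v.

Let quadratic_le v : dot v (P *m v) <= Q * enorm v ^+ 2.
Proof.
rewrite (le_trans (cauchy_schwarz _ _))// expr2 mulrCA.
by rewrite ler_wpM2l// enorm_ge0.
Qed.

Let c := Q ^+ 2 / eps.

Let c_gt0 : 0 < c.
Proof. by rewrite divr_gt0// exprn_gt0. Qed.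

Lemma errors_enorm_le xi e t : W xi -> errors sys obs xi e -> 0 <= t ->
  enorm (e t) <=
    Num.sqrt (M * dot (e 0) (P *m e 0)) * expR (- (eps / Q / 2 * t)) +
    Num.sqrt (M * (Q ^+ 2 / eps)) *
      Num.sqrt (\int[mu]_(s in `[0, t]) enorm (xi s) ^+ 2).
Proof.
move=> Wxi ee t0; have eac := errors_abs_continuous ee.
have wc := within_continuous_sqr_enorm Wxi.1.
have := dissipation_exponential P_posdef eac wc (fun=> sqr_ge0 _)
  (ltW eps_gt0) (ltW c_gt0) (errors_dissipative (ltW Q_gt0) P_bounded Wxi ee)
  t0 Q_gt0 quadratic_le.
rewrite (@eq_Rintegral _ _ _ mu _ (fun s => enorm (xi s) ^+ 2)); last first.
  by move=> s; rewrite inE/= in_itv/= => /andP[s0 _]; rewrite max_r.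
set J := Rintegral _ _ _ => VJ.
have J0 : 0 <= J by apply: Rintegral_ge0 => s _; exact: sqr_ge0.
set V0 := dot (e 0) _ in VJ *.
have V00 : 0 <= V0 by exact: posdef_ge0.
have eVJ : enorm (e t) ^+ 2 <=
    M * V0 * expR (- (eps / Q / 2 * t)) ^+ 2 + M * c * J.
  (* The error decays at half the rate eps / Q of V, since V is quadratic in it. *)
  rewrite [expR _ ^+ 2]expr2 -expRD.
  rewrite (_ : - _ + - _ = - (eps / Q * t)); last first.
    by field; rewrite gt_eqF.
  rewrite -(mulrA M V0) -(mulrA M c) -mulrDr (le_trans (P_coercive _))//.
  by rewrite ler_pM2l.
rewrite -[leLHS]ger0_norm ?enorm_ge0// -sqrtr_sqr.
apply: le_trans (_ : _ <= Num.sqrt (M * V0 * expR (- (eps / Q / 2 * t)) ^+ 2 +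
  M * c * J)) _; first by rewrite ler_wsqrtr.
have Mc0 : 0 <= M * c by rewrite mulr_ge0 ?ltW.
have MV0 : 0 <= M * V0 by rewrite mulr_ge0// ltW.
apply: le_trans (sqrtrD_le (mulr_ge0 MV0 (sqr_ge0 _)) (mulr_ge0 Mc0 J0)) _.
rewrite (sqrtrM _ MV0) (sqrtrM _ Mc0) sqrtr_sqr.
by rewrite [X in _ * X](ger0_norm (expR_ge0 _)).
Qed.

(** Dropping V(t) >= 0 from the integrated inequality bounds the integral of |e|^2 over [0, t]
    uniformly in t; the bound passes to the half-line, and the square root is subadditive. *)
Lemma errors_L2norm_le xi e : W xi -> errors sys obs xi e ->
  (L2norm xi < +oo)%E ->
  (L2norm e <= (Num.sqrt (dot (e 0%R) (P *m e 0%R) / eps))%:E +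
    (Num.sqrt (Q ^+ 2 / eps / eps))%:E * L2norm xi)%E.
Proof.
move=> Wxi ee; have eac := errors_abs_continuous ee.
have wc := within_continuous_sqr_enorm Wxi.1.
have V00 : 0 <= dot (e 0) (P *m e 0) by exact: posdef_ge0.
have maxE n' (g : traj R n') :
    (\int[mu]_(t in `]0%R, +oo[) (enorm (g t) ^+ 2)%:E =
     \int[mu]_(t in `]0%R, +oo[) (enorm (g (Num.max 0%R t)) ^+ 2)%:E)%E.
  apply: eq_integral => t; rewrite inE/= in_itv/= andbT => t0.
  by rewrite max_r// ltW.
rewrite !L2normE (maxE _ e) (maxE _ xi).
set Ix := integral _ _ _; have : (0 <= Ix)%E.
  by apply: integral_ge0 => t _; rewrite lee_fin sqr_ge0.
case IxE : Ix => [s| |]//; last first.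
  by rewrite poweRyr ?invr_neq0 ?pnatr_eq0// ltxx.
rewrite lee_fin => s0 _.
have Js t : \int[mu]_(z in `[0, t]) enorm (xi (Num.max 0 z)) ^+ 2 <= s.
  by rewrite -lee_fin -IxE; apply: integral_itv_le_oy => // z; exact: sqr_ge0.
have Ie : (\int[mu]_(t in `]0%R, +oo[) (enorm (e (Num.max 0%R t)) ^+ 2)%:E <=
    ((dot (e 0%R) (P *m e 0%R) + c * s) / eps)%:E)%E.
  apply: integral_oy_le => [|z|t t0].
  - by move=> t; apply: cvgM; exact: loc_abs_continuous_enorm.
  - exact: sqr_ge0.
  have := dissipation_integral P_posdef eac wc
    (errors_dissipative (ltW Q_gt0) P_bounded Wxi ee) t0.
  have := ler_wpM2l (ltW c_gt0) (Js t).
  have := posdef_ge0 (e t) P_posdef.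
  rewrite ler_pdivlMr// [_ * eps]mulrC -/c; lra.
have cs0 : 0 <= c * s by rewrite mulr_ge0// ltW.
have div_eps a : 0 <= a -> 0 <= a / eps.
  by move=> a0; rewrite divr_ge0// ltW.
apply: (@le_trans _ _
    (((dot (e 0%R) (P *m e 0%R) + c * s) / eps)%:E `^ 2^-1)%E).
  apply: gt0_ler_poweR Ie => //; rewrite in_itv/= leey andbT.
    by apply: integral_ge0 => t _; rewrite lee_fin sqr_ge0.
  by rewrite lee_fin div_eps// addr_ge0.
rewrite !poweR_EFin !powR12_sqrt//; last by rewrite div_eps// addr_ge0.
rewrite -EFinM -EFinD lee_fin -sqrtrM; last by rewrite div_eps// ltW.
rewrite mulrDl (le_trans (sqrtrD_le (div_eps _ V00) (div_eps _ cs0)))//.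
by rewrite mulrAC.
Qed.

Lemma errors_asymptotically_stable : W (fun=> 0) ->
  asymptotically_stable (errors sys obs (fun=> 0)).
Proof.
move=> W0.
have ee e t : errors sys obs (fun=> 0) e -> 0 <= t -> enorm (e t) <=
    Num.sqrt (M * dot (e 0) (P *m e 0)) * expR (- (eps / Q / 2 * t)).
  move=> ee t0; apply: le_trans (errors_enorm_le W0 ee t0) _.
  rewrite (_ : Rintegral _ _ _ = 0) ?sqrtr0 ?mulr0 ?addr0//.
  under eq_Rintegral do rewrite enorm0 expr0n/=.
  by rewrite Rintegral_cst//= mul0r.
have a0 : 0 < eps / Q / 2 by rewrite !divr_gt0.
split.
  move=> h h0; have MQ0 : 0 < M * Q by rewrite mulr_gt0.
  (* The amplitude of the pointwise bound is at most sqrt (M Q) |e(0)|, because V(0) <= Q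
     |e(0)|^2. *)
  exists (h / Num.sqrt (M * Q)) => [|e eE e0 t t0].
    by rewrite divr_gt0// sqrtr_gt0.
  apply: le_lt_trans (ee e t eE t0) _.
  move: e0; rewrite ltr_pdivlMr ?sqrtr_gt0//; apply: le_lt_trans.
  apply: le_trans (_ : _ <= Num.sqrt (M * dot (e 0) (P *m e 0))) _.
    rewrite ler_piMr ?sqrtr_ge0// -[leRHS]expR0 ler_expR oppr_le0.
    by apply: mulr_ge0 => //; exact: ltW.
  rewrite -[enorm _]ger0_norm ?enorm_ge0// -sqrtr_sqr -sqrtrM ?sqr_ge0//.
  by rewrite ler_wsqrtr// mulrCA ler_pM2l// mulrC.
move=> e eE; apply/cvgrPdist_lt => h h0; near=> t.
rewrite sub0r normrN; apply: le_lt_trans (ler_mxnorm_enorm _) _.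
have t0 : 0 <= t by near: t; exact: nbhs_pinfty_ge.
apply: le_lt_trans (ee e t eE t0) _.
set G := Num.sqrt _.
(* Past this time h (1 + rate t) exceeds G, and 1 + y <= exp y turns this into G exp(- rate t) <
   h. *)
have tG : G / h / (eps / Q / 2) <= t.
  by near: t; apply: nbhs_pinfty_ge; rewrite num_real.
rewrite expRN ltr_pdivrMr ?expR_gt0//.
apply: lt_le_trans (_ : h * (1 + eps / Q / 2 * t) <= _); last first.
  by rewrite ler_pM2l// expR_ge1Dx.
move: tG; rewrite ler_pdivrMr// ler_pdivrMr// => tG.
by rewrite mulrDr mulr1 [_ / 2 * t]mulrC [h * (t * _)]mulrC; lra.
Unshelve. all: by end_near. Qed.

End sliding_observer_errors.

Theorem theorem3 (R : realType) (n m p r : nat)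
  (A : 'M[R]_n) (B : 'M[R]_(n, m)) (C : 'M[R]_(m, n)) (F : 'M[R]_(p, n))
  (calF : 'cV[R]_m -> set 'cV[R]_m)
  (f : 'cV[R]_n -> 'cV[R]_r -> 'cV[R]_n) (u : R -> 'cV[R]_r)
  (Lf eps : R) (P : 'M[R]_n) (L : 'M[R]_(n, p)) (K : 'M[R]_(m, p))
  (kappa1 kappa2 kappa3 : R -> R) (delta : R)
  (calF_maxmono : maximal_monotone calF)
  (Lf_ge0 : 0 <= Lf)
  (f_lip : forall x1 x2 v, enorm (f x1 v - f x2 v) <= Lf * enorm (x1 - x2))
  (eps_gt0 : 0 < eps)
  (P_posdef : posdef P)
  (lmi : neg_semidef (lmi_mx A F P L Lf eps))
  (BP : B^T *m P = C - K *m F)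
  (kappa1_cont : {within `[0, +oo[, continuous kappa1})
  (kappa2_cont : {within `[0, +oo[, continuous kappa2})
  (kappa3_cont : {within `[0, +oo[, continuous kappa3})
  (kappa1_gt0 : forall t : R, 0 <= t -> 0 < kappa1 t)
  (kappa2_gt0 : forall t : R, 0 <= t -> 0 < kappa2 t)
  (kappa3_ge0 : forall t : R, 0 <= t -> 0 <= kappa3 t)
  (delta_gt0 : 0 < delta) :
  let sys := lure_system A B C F calF f u in
  let obs := sliding_observer A B C F calF f u P L K kappa1 kappa3 delta in
  let W := admissible_uncertainty F P kappa1 kappa2 in
  T_observer W sys obs /\
  ((exists2 mu : R, 0 < mu &
      neg_semidef (block_mx (lmi_mx A F P L Lf eps) (- P)
                            (- P) (- (2 * mu * eps)%:M))) ->
   strong_Hinfty_observer W sys obs).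
Proof.
move=> sys obs W.
have [M M0 PM] := posdef_coercive P_posdef.
have [Q Q0 PQ] := mulmx_bounded P.
have W0 : W (fun=> 0).
  by apply: admissible_uncertainty0 => t t0;
    rewrite ltW// (kappa1_gt0, kappa2_gt0).
have stable : asymptotically_stable (errors sys obs (fun=> 0)).
  exact: (errors_asymptotically_stable _ calF_maxmono.1 eps_gt0 f_lip P_posdef
    lmi BP delta_gt0 kappa3_ge0 M0 Q0 PM PQ W0).
have c0 : 0 < Q ^+ 2 / eps by rewrite divr_gt0// exprn_gt0.
split => [|_]; split => //.
  (* [M] comes from coercivity of P, and Q^2 / eps is the weight that Young's inequality puts on
     |xi|^2. *)
  exists (Num.sqrt (M * (Q ^+ 2 / eps))), (fun e0 t =>
    Num.sqrt (M * dot e0 (P *m e0)) * expR (- (eps / Q / 2 * t))).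
  split.
  - by rewrite sqrtr_gt0 mulr_gt0.
  - by move=> t t0; rewrite dot0l mulr0 sqrtr0 mul0r.
  - move=> e0 _; exists (Num.sqrt (M * dot e0 (P *m e0))), (eps / Q / 2).
    split=> [|t t0]; first by rewrite !divr_gt0.
    by rewrite ger0_norm// mulr_ge0 ?sqrtr_ge0 ?expR_ge0.
  - move=> xi Wxi _ e ee t t0.
    exact: (errors_enorm_le calF_maxmono.1 eps_gt0 f_lip P_posdef lmi
      BP delta_gt0 kappa3_ge0 M0 Q0 PM PQ Wxi ee t0).
(* The second division by [eps] comes from the coefficient of |e|^2 in the dissipation
   inequality. *)
exists (Num.sqrt (Q ^+ 2 / eps / eps)), (fun e0 =>
  Num.sqrt (dot e0 (P *m e0) / eps)); split.
- by rewrite sqrtr_gt0 divr_gt0.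
- by move=> e0; exact: sqrtr_ge0.
- by rewrite dot0l mul0r sqrtr0.
move=> xi Wxi [_ xioo] e ee.
exact: (errors_L2norm_le calF_maxmono.1 eps_gt0 f_lip P_posdef lmi
  BP delta_gt0 kappa3_ge0 Q0 PQ Wxi ee xioo).
Qed.
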